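(* If $A$ is a completely positive matrix, then $\tau_{\mathrm{cp}}(A)\ge c_{\mathrm{frac}}(G(A))$.
   Context: A real symmetric $n\times n$ matrix $A$ is completely positive if $A=\sum_{i=1}^r a_ia_i^T$ for some $r$ and some entrywise nonnegative vectors $a_i\in\mathbb R^n$. Below, $\le$ between matrices is the entrywise inequality, $X\preceq Y$ means $Y-X$ is positive semidefinite, and $\operatorname{conv}$ is the convex hull. Define $$\mathcal A_{\mathrm{cp}}(A)=\{R \text{ real symmetric } n\times n: \operatorname{rank}R\le 1,\ 0\le R\le A,\ 0\preceq R\preceq A\},$$ $$\tau_{\mathrm{cp}}(A)=\inf\{t\ge 0: A\in t\,\operatorname{conv}(\mathcal A_{\mathrm{cp}}(A))\}=\max\{L(A): L\text{ linear},\ L(R)\le 1\ \forall R\in\mathcal A_{\mathrm{cp}}(A)\}.$$ $G(A)$ is the graph on vertex set $\{1,\dots,n\}$ in which $i$ and $j$ are joined by an edge when $A_{i,j}>0$ (every nonzero entry of $A$, including nonzero diagonal entries, counts as an edge to be covered). Let $$\mathcal A_{\mathrm{cl}}(A)=\{R=bb^T: b\in\{0,1\}^n,\ R_{i,j}=1\Rightarrow A_{i,j}>0\}$$ be the set of matrices representing cliques of $G(A)$. The fractional edge-clique cover number $c_{\mathrm{frac}}(G(A))$ is the minimum of $\sum_C x_C$ over nonnegative weights $x_C$ on the cliques $C$ of $G(A)$ such that every edge is covered with total weight at least $1$; equivalently, $$c_{\mathrm{frac}}(G(A))=\min\{t\ge 0: \exists\, Y\in t\,\operatorname{conv}(\mathcal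 A_{\mathrm{cl}}(A)) \text{ such that } Y_{i,j}\ge 1 \text{ for all }(i,j)\text{ with }A_{i,j}>0\}.$$ *)

(* Defs.v *)
From mathcomp Require Import all_boot all_order all_algebra.
From mathcomp Require Import all_classical all_reals all_analysis.

Set Implicit Arguments.
Unset Strict Implicit.
Unset Printing Implicit Defensive.

Import Order.TTheory GRing.Theory Num.Theory.
Import numFieldNormedType.Exports.
Local Open Scope classical_set_scope.
Local Open Scope ring_scope.

Definition lemx (R : realType) (n : nat) (X Y : 'M[R]_n) : Prop :=
  forall i j, X i j <= Y i j.

Definition psd (R : realType) (n : nat) (M : 'M[R]_n) : Prop :=
  M \is symmetricmx /\ forall x : 'cV[R]_n, 0 <= (x^T *m M *m x) 0 0.

Definition lepsd (R : realType) (n : nat) (X Y : 'M[R]_n) : Prop :=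
  psd (Y - X).

Definition completely_positive (R : realType) (n : nat) (A : 'M[R]_n) : Prop :=
  exists (r : nat) (a : 'I_r -> 'cV[R]_n),
    (forall k i, 0 <= a k i 0) /\ A = \sum_(k < r) a k *m (a k)^T.

Definition convex_hull (R : realType) (n : nat) (S : set 'M[R]_n) :
  set 'M[R]_n := smallest (@convex_set R 'M[R]_n) S.

Definition Acp (R : realType) (n : nat) (A : 'M[R]_n) : set 'M[R]_n :=
  [set X | [/\ X \is symmetricmx, (\rank X <= 1)%N,
               lemx 0 X /\ lemx X A & lepsd 0 X /\ lepsd X A]].

(* Extended-real valued: +oo when no t is feasible. *)
Definition tau_cp (R : realType) (n : nat) (A : 'M[R]_n) : \bar R :=
  ereal_inf [set t%:E | t in [set t : R |
    0 <= t /\ [set t *: X | X in convex_hull (Acp A)] A]].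

(* A graph is a relation that may have loops: a vertex i with 0 < A i i carries
   a loop, which counts as an edge to be covered. *)
Definition support_graph (R : realType) (n : nat) (A : 'M[R]_n) : rel 'I_n :=
  fun i j => 0 < A i j.

(* The case i = j is included: every vertex of a clique carries a loop. *)
Definition clique (n : nat) (e : rel 'I_n) (C : {set 'I_n}) : bool :=
  [forall i in C, forall j in C, e i j].

Definition fractional_clique_cover (R : realType) (n : nat) (e : rel 'I_n)
    (x : {set 'I_n} -> R) : Prop :=
  (forall C, clique e C -> 0 <= x C) /\
  (forall i j, e i j ->
     1 <= \sum_(C : {set 'I_n} | [&& clique e C, i \in C & j \in C]) x C).

(* A minimum of a linear program, written as an infimum (+oo if infeasible). *)
Definition c_frac (R : realType) (n : nat) (e : rel 'I_n) : \bar R :=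
  ereal_inf [set (\sum_(C : {set 'I_n} | clique e C) x C)%:E
            | x in fractional_clique_cover (R := R) e].

(* Main.v *)
(* A symmetric matrix X of rank at most 1 satisfies X_ij ^ 2 = X_ii X_jj, so if
   moreover 0 <= X <= A entrywise, then the support of X is a clique C of G(A),
   and X_ij <= A_ij if i, j are in C while X_ij = 0 otherwise. Taking a convex
   combination of such matrices and giving each clique the weight of its
   matrices, A = t X yields A_ij <= t A_ij w(cliques containing i and j);
   dividing by A_ij > 0 shows that t w is a fractional clique cover. *)

Require Import Defs.
From mathcomp Require Import all_boot all_order all_algebra.
From mathcomp Require Import all_classical all_reals all_analysis.
From mathcomp Require Import ring.

Set Implicit Arguments.
Unset Strict Implicit.
Unset Printing Implicit Defensive.

Import Order.TTheory GRing.Theory Num.Theory.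
Import numFieldNormedType.Exports.
Local Open Scope classical_set_scope.
Local Open Scope ring_scope.

(** Factoring [X] through dimension 0 or 1 makes its entries either all zero or products of a row
    factor and a column factor. *)
Lemma rank_le1_minor (F : fieldType) (m n : nat) (X : 'M[F]_(m, n)) i j k l :
  (\rank X <= 1)%N -> X i j * X k l = X i l * X k j.
Proof.
move: (mulmx_base X).
case: (\rank X) (col_base X) (row_base X) => [|[|//]] U V <- _.
  by rewrite !mxE !big_ord0 !mul0r.
by rewrite !mxE !big_ord1; ring.
Qed.

(** Here [w] is a probability distribution on cliques. Mixing distributions preserves the bound, so
    this set is convex and contains the hull of [Acp A] as soon as it contains [Acp A]. *)
Definition clique_dominated (R : realType) (n : nat) (A : 'M[R]_n) :
    set 'M[R]_n :=
  [set X | exists w : {set 'I_n} -> R,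
    [/\ forall C, 0 <= w C,
        \sum_(C : {set 'I_n} | clique (support_graph A) C) w C = 1
      & forall i j, X i j <= A i j *
        \sum_(C : {set 'I_n} |
           [&& clique (support_graph A) C, i \in C & j \in C]) w C]].

Lemma clique_dominated_convex (R : realType) (n : nat) (A : 'M[R]_n) :
  @convex_set R 'M[R]_n (clique_dominated A).
Proof.
move=> X Y l; rewrite !inE => -[u [u0 u1 uX]] [v [v0 v1 vY]].
have l0 : 0 <= l%:num :> R by [].
have l1 : 0 <= 1 - l%:num :> R by rewrite subr_ge0.
exists (fun C => l%:num * u C + (1 - l%:num) * v C); split.
- by move=> C; rewrite addr_ge0 ?mulr_ge0.
- by rewrite big_split/= -!mulr_sumr u1 v1 !mulr1 addrC subrK.
- move=> i j; rewrite big_split/= -!mulr_sumr mulrDr.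
  rewrite [leLHS](_ : _ = l%:num * X i j + (1 - l%:num) * Y i j).
    by rewrite [in leRHS]mulrCA [X in _ <= _ + X]mulrCA lerD ?ler_wpM2l.
  by rewrite [LHS]mxE; congr (_ + _); rewrite mxE.
Qed.

Lemma Acp_clique_dominated (R : realType) (n : nat) (A : 'M[R]_n) :
  Acp A `<=` clique_dominated A.
Proof.
move=> X [/= Xsym Xrk [X0 XA] _].
have X_ge0 i j : 0 <= X i j by move: (X0 i j); rewrite mxE.
have Xsqr i j : X i j ^+ 2 = X i i * X j j.
  move/is_hermitianmxP: Xsym => /(congr1 (fun M : 'M[R]_n => M j i)).
  rewrite expr0 scale1r !mxE /= => XT.
  by rewrite expr2 -{2}XT; apply: rank_le1_minor.
(* By [Xsqr] the diagonal determines the support of [X], which is [C0] times itself. *)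
set C0 := [set i | 0 < X i i]%SET.
have C0P i j : 0 < X i j -> (i \in C0) && (j \in C0).
  move=> Xij; have : X i i * X j j != 0 by rewrite -Xsqr expf_neq0 ?gt_eqF.
  by rewrite mulf_eq0 negb_or !inE !lt0r !X_ge0 !andbT.
have C0_clique : clique (support_graph A) C0.
  apply/forall_inP => i; rewrite inE => Xi; apply/forall_inP => j.
  rewrite inE => Xj; apply: lt_le_trans (XA i j).
  by rewrite lt0r X_ge0 andbT -sqrf_eq0 Xsqr gt_eqF ?mulr_gt0.
(* The point mass at [C0]. *)
exists (fun C => (C == C0)%:R); split=> [C||i j]; first exact: ler0n.
  by rewrite (bigD1 C0)//= eqxx big1 ?addr0// => C /andP[_ /negPf->].
have sum_ge0 : 0 <= \sum_(C : {set 'I_n} | [&& clique (support_graph A) C,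
    i \in C & j \in C]) (C == C0)%:R :> R by apply: sumr_ge0 => C _; exact: ler0n.
have A_ge0 : 0 <= A i j := le_trans (X_ge0 i j) (XA i j).
have [->|X_neq0] := eqVneq (X i j) 0; first exact: mulr_ge0.
have /C0P C0ij : 0 < X i j by rewrite lt0r X_neq0 X_ge0.
rewrite (bigD1 C0) /= ?C0_clique//.
rewrite eqxx big1 ?addr0 ?mulr1; first exact: XA.
by move=> C /andP[_ /negPf->].
Qed.

Theorem theorem9 (R : realType) (n : nat) (A : 'M[R]_n) :
  completely_positive A ->
  (c_frac R (support_graph A) <= tau_cp A)%E.
Proof.
move=> _; apply: le_ereal_inf_tmp => _ [t [t0 [X hullX tXA]] <-].
have /= [w [w0 w1 Xw]] : clique_dominated A X.
  move: X hullX {tXA}; apply: smallest_sub; first exact: clique_dominated_convex.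
  exact: Acp_clique_dominated.
apply: ge_ereal_inf; exists t%:E => //.
exists (fun C => t * w C); last by rewrite -mulr_sumr w1 mulr1.
split=> [C _|i j Aij]; first exact: mulr_ge0.
(* Multiplied by [A i j], which equals [t * X i j], the cover condition becomes [t] times the bound
   [Xw]. *)
rewrite -mulr_sumr -(ler_pM2l Aij) mulr1 mulrCA.
rewrite -[leLHS](congr1 (fun M : 'M[R]_n => M i j) tXA) mxE.
exact: ler_wpM2l.
Qed.
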